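(* The de Rham differential $d$ induces maps $d:H_k(\mathbb{R}^4,\pi)\to H_{k+1}(\mathbb{R}^4,\pi)$ on formal Poisson homology, and the cohomology of the complex $(H_\bullet(\mathbb{R}^4,\pi),d)$ is $$H^k_{DR}(H_\bullet(\mathbb{R}^4,\pi),d)\cong\begin{cases}\mathbb{R}&\text{if }k=0,\\0&\text{otherwise.}\end{cases}$$
   Context: Let $x_1,\dots,x_4$ be the coordinates on $\mathbb{R}^4$, $\mu=dx_1\wedge dx_2\wedge dx_3\wedge dx_4$, $f_1=x_1^2-x_2^2+x_3^2-x_4^2$, $f_2=2(x_1x_2+x_3x_4)$. Let $\mathcal{R}=\mathbb{R}[[x_1,x_2,x_3,x_4]]$ and $\Omega^k_f=\mathcal{R}\otimes\wedge^k(\mathbb{R}^4)^*$ (formal differential forms), with de Rham differential $d$. The Poisson bivector $\pi$ on $\mathbb{R}^4$ is determined by $\pi(dg,dh)\,\mu=dg\wedge dh\wedge df_1\wedge df_2$. Contraction is $\iota_{X_1\wedge\dots\wedge X_k}=\iota_{X_k}\cdots\iota_{X_1}$. The Poisson homology differential is $\delta_\pi=\iota_\pi\circ d-d\circ\iota_\pi:\Omega^k_f\to\Omega^{k-1}_f$ and $H_k(\mathbb{R}^4,\pi)=\ker(\delta_\pi|_{\Omega^k_f})/\delta_\pi(\Omega^{k+1}_f)$. One has $d\delta_\pi+\delta_\pi d=0$, so $d$ descends to homology. *)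

(* Defs.v *)
From HB Require Import structures.
From mathcomp Require Import all_boot all_order all_algebra.
From mathcomp Require Import ring boolp reals mpoly.

Set Implicit Arguments.
Unset Strict Implicit.
Unset Printing Implicit Defensive.

Import GRing.Theory.
Local Open Scope ring_scope.

Record fps (n : nat) (R : Type) := Fps { fcoef :> 'X_{1..n} -> R }.

Section SeriesZmod.
Variables (n : nat) (R : comNzRingType).
Implicit Types f g h : fps n R.

Lemma fpsP f g : f =1 g -> f = g.
Proof. by case: f g => [f] [g] /= /funext ->. Qed.

HB.instance Definition _ := gen_eqMixin (fps n R).
HB.instance Definition _ := gen_choiceMixin (fps n R).

Definition fps_zero : fps n R := Fps (fun=> 0).
Definition fps_opp f : fps n R := Fps (fun m => - f m).
Definition fps_add f g : fps n R := Fps (fun m => f m + g m).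

Fact fps_addA : associative fps_add.
Proof. by move=> f g h; apply: fpsP => m /=; rewrite addrA. Qed.
Fact fps_addC : commutative fps_add.
Proof. by move=> f g; apply: fpsP => m /=; rewrite addrC. Qed.
Fact fps_add0 : left_id fps_zero fps_add.
Proof. by move=> f; apply: fpsP => m /=; rewrite add0r. Qed.
Fact fps_addN : left_inverse fps_zero fps_opp fps_add.
Proof. by move=> f; apply: fpsP => m /=; rewrite addNr. Qed.

HB.instance Definition _ :=
  GRing.isZmodule.Build (fps n R) fps_addA fps_addC fps_add0 fps_addN.

Lemma fps0E m : (0 : fps n R) m = 0. Proof. by []. Qed.
Lemma fpsDE f g m : (f + g) m = f m + g m. Proof. by []. Qed.
Lemma fpsNE f m : (- f) m = - f m. Proof. by []. Qed.
Lemma fps_sumE I (r : seq I) (P : pred I) (F : I -> fps n R) m :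
  (\sum_(i <- r | P i) F i) m = \sum_(i <- r | P i) F i m.
Proof. exact: (big_morph (fun f : fps n R => f m)). Qed.

Definition fps_scale (a : R) f : fps n R := Fps (fun m => a * f m).

Fact fps_scaleA a b f : fps_scale a (fps_scale b f) = fps_scale (a * b) f.
Proof. by apply: fpsP => m /=; rewrite mulrA. Qed.
Fact fps_scale1 : left_id 1 fps_scale.
Proof. by move=> f; apply: fpsP => m /=; rewrite mul1r. Qed.
Fact fps_scaleDr : right_distributive fps_scale +%R.
Proof. by move=> a f g; apply: fpsP => m /=; rewrite mulrDr. Qed.
Fact fps_scaleDl f : {morph fps_scale^~ f : a b / a + b}.
Proof. by move=> a b; apply: fpsP => m /=; rewrite mulrDl. Qed.

HB.instance Definition _ := GRing.Zmodule_isLmodule.Build R (fps n R)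
  fps_scaleA fps_scale1 fps_scaleDr fps_scaleDl.

Lemma fpsZE a f m : (a *: f) m = a * f m. Proof. by []. Qed.

Definition fps_one : fps n R := Fps (fun m => (m == 0%MM)%:R).

(* Cauchy product; the double bound on the degrees only makes the index set
   finite, it is implied by the filter *)
Definition fps_mul f g : fps n R := Fps (fun m =>
  \sum_(k : 'X_{1..n < (mdeg m).+1, (mdeg m).+1} | m == (k.1 + k.2)%MM)
     f k.1 * g k.2).

Let tr d f : {mpoly R[n]} := \sum_(k : 'X_{1..n < d}) f k *: 'X_[k].

Let trE d f m : (mdeg m < d)%N -> (tr d f)@_m = f m.
Proof.
move=> ltmd; rewrite /tr raddf_sum /= (bigD1 (BMultinom ltmd)) //=.
rewrite mcoeffZ mcoeffX eqxx mulr1 big1 ?addr0 // => k.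
rewrite -val_eqE /= => ne_km.
by rewrite mcoeffZ mcoeffX (negPf ne_km) mulr0.
Qed.

Let mdeg_summand (m m1 m2 : 'X_{1..n}) : m == (m1 + m2)%MM ->
  (mdeg m1 <= mdeg m)%N /\ (mdeg m2 <= mdeg m)%N.
Proof. by move=> /eqP->; rewrite mdegD leq_addr leq_addl. Qed.

Let mul_tr d f g m : (mdeg m < d)%N -> (fps_mul f g) m = (tr d f * tr d g)@_m.
Proof.
move=> ltmd; rewrite mcoeffM; apply: eq_bigr => k /mdeg_summand[le1 le2].
by rewrite !trE // (leq_ltn_trans _ ltmd).
Qed.

Fact fps_mulC : commutative fps_mul.
Proof.
move=> f g; apply: fpsP => m.
by rewrite !(@mul_tr (mdeg m).+1) // mulrC.
Qed.

Fact fps_mulA : associative fps_mul.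
Proof.
move=> f g h; apply: fpsP => m; set d := (mdeg m).+1.
transitivity ((tr d f * (tr d g * tr d h))@_m).
  rewrite mcoeffM; apply: eq_bigr => k /mdeg_summand[le1 le2].
  by rewrite trE // (mul_tr _ _ (_ : _ < d)%N).
rewrite mulrA mcoeffM; apply: eq_bigr => k /mdeg_summand[le1 le2].
by rewrite (trE h) // (mul_tr _ _ (_ : _ < d)%N).
Qed.

Fact fps_mul1 : left_id fps_one fps_mul.
Proof.
move=> f; apply: fpsP => m; rewrite (@mul_tr (mdeg m).+1) //.
have lt0 : (mdeg (0%MM : 'X_{1..n}) < (mdeg m).+1)%N by rewrite mdeg0.
have ->: tr (mdeg m).+1 fps_one = 1.
  rewrite /tr (bigD1 (BMultinom lt0)) //= eqxx scale1r mpolyX0.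
  rewrite big1 ?addr0 // => k.
  by rewrite -val_eqE /= => /negPf->; rewrite scale0r.
by rewrite mul1r trE.
Qed.

Fact fps_mulDl : left_distributive fps_mul +%R.
Proof.
move=> f g h; apply: fpsP => m /=; rewrite -big_split /=.
by apply: eq_bigr => k _; rewrite mulrDl.
Qed.

Fact fps_oner_neq0 : fps_one != 0.
Proof.
apply/eqP => /(congr1 (fun f : fps n R => f 0%MM)) /=.
by rewrite eqxx => /eqP; rewrite oner_eq0.
Qed.

HB.instance Definition _ := GRing.Zmodule_isComNzRing.Build (fps n R)
  fps_mulA fps_mulC fps_mul1 fps_mulDl fps_oner_neq0.

Lemma fpsME f g m : (f * g) m =
  \sum_(k : 'X_{1..n < (mdeg m).+1, (mdeg m).+1} | m == (k.1 + k.2)%MM)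
     f k.1 * g k.2.
Proof. by []. Qed.

Lemma fps1E m : (1 : fps n R) m = (m == 0%MM)%:R.
Proof. by []. Qed.

Fact fps_scaleAl (a : R) f g : a *: (f * g) = (a *: f) * g.
Proof.
apply: fpsP => m; rewrite fpsZE !fpsME mulr_sumr.
by apply: eq_bigr => k _; rewrite fpsZE mulrA.
Qed.

HB.instance Definition _ :=
  GRing.Lmodule_isLalgebra.Build R (fps n R) fps_scaleAl.
HB.instance Definition _ := GRing.Lalgebra_isComAlgebra.Build R (fps n R).

Definition fpsX (i : 'I_n) : fps n R := Fps (fun m => (m == U_(i)%MM)%:R).

(* d/dx_i: (\sum_m f_m x^m) = \sum_m (m_i + 1) f_(m + e_i) x^m *)
Definition fpsderiv (i : 'I_n) f : fps n R :=
  Fps (fun m => f (m + U_(i))%MM *+ (m i).+1).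

End SeriesZmod.

Section Subspaces.
Variables (R : nzRingType) (U V W : lmodType R).
Variables (g : {linear U -> V}) (f : {linear V -> W}).

Definition ker_pred : {pred V} := [pred x | f x == 0].
Fact ker_pred_submod : submod_closed ker_pred.
Proof.
split=> [|a x y]; rewrite !inE ?linear0 // => /eqP fx0 /eqP fy0.
by rewrite linearP fx0 fy0 scaler0 addr0.
Qed.
HB.instance Definition _ :=
  GRing.isSubmodClosed.Build R V ker_pred ker_pred_submod.

Definition kernel := {x : V | x \in ker_pred}.
HB.instance Definition _ := SubChoice.on kernel.
HB.instance Definition _ := [SubChoice_isSubLmodule of kernel by <:].

Lemma kernelP (z : kernel) : f (val z) = 0.
Proof. by have := valP z; rewrite inE => /eqP. Qed.

(* the elements of ker f that lie in the image of g; the classical truth value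
   [`[< _ >]] is needed because subspaces are boolean predicates *)
Definition im_pred : {pred kernel} := [pred z | `[< exists u, val z = g u >]].
Fact im_pred_submod : submod_closed im_pred.
Proof.
split=> [|a x y].
  by rewrite inE; apply/asboolP; exists 0; rewrite linear0.
rewrite !inE => /asboolP[u xE] /asboolP[v yE]; apply/asboolP.
by exists (a *: u + v); rewrite linearP -xE -yE.
Qed.
HB.instance Definition _ :=
  GRing.isSubmodClosed.Build R kernel im_pred im_pred_submod.

End Subspaces.

Arguments im_pred {R U V W} g f.

Section Homology.
Variables (R : nzRingType) (U V W : lmodType R).
Variables (g : {linear U -> V}) (f : {linear V -> W}).

(* ker f / (im g :&: ker f), that is, ker f / im g when f \o g = 0 *)
Definition homology := Quotient.quot (im_pred g f).
HB.instance Definition _ := GRing.Zmodule.on homology.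

Definition hclass (z : kernel f) : homology := (\pi_(homology) z)%qT.

Lemma hclass_surj (c : homology) : exists z, c = hclass z.
Proof. by exists (repr c); rewrite /hclass reprK. Qed.

Let hclassB z1 z2 : hclass z1 = hclass z2 <-> z1 - z2 \in im_pred g f.
Proof. by rewrite Quotient.idealrBE; split=> /eqP. Qed.

Lemma hclass_eq z1 z2 :
  hclass z1 = hclass z2 <-> exists u, val z1 - val z2 = g u.
Proof. by rewrite hclassB; split=> [/asboolP|?]; last exact/asboolP. Qed.

Let hclassD : {morph hclass : x y / x + y}.
Proof. exact: raddfD. Qed.

Definition hscale (a : R) (c : homology) : homology := hclass (a *: repr c).

Let hscaleE a z : hscale a (hclass z) = hclass (a *: z).
Proof.
apply/hclassB; rewrite -scalerBr rpredZ //; apply/hclassB.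
by rewrite /hclass reprK.
Qed.

Fact hscaleA a b c : hscale a (hscale b c) = hscale (a * b) c.
Proof. by have [z ->] := hclass_surj c; rewrite !hscaleE scalerA. Qed.
Fact hscale1 : left_id 1 hscale.
Proof.
by move=> c; have [z ->] := hclass_surj c; rewrite hscaleE scale1r.
Qed.
Fact hscaleDr : right_distributive hscale +%R.
Proof.
move=> a c1 c2; have [z1 ->] := hclass_surj c1; have [z2 ->] := hclass_surj c2.
by rewrite -hclassD !hscaleE -hclassD scalerDr.
Qed.
Fact hscaleDl c : {morph hscale^~ c : a b / a + b}.
Proof.
move=> a b; have [z ->] := hclass_surj c.
by rewrite !hscaleE -hclassD scalerDl.
Qed.
HB.instance Definition _ := GRing.Zmodule_isLmodule.Build R homology
  hscaleA hscale1 hscaleDr hscaleDl.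

Fact hclass_is_linear : linear hclass.
Proof. by move=> a x y; rewrite hclassD -hscaleE. Qed.
HB.instance Definition _ :=
  GRing.isLinear.Build R (kernel f) homology _ hclass hclass_is_linear.

End Homology.

Section InducedMap.
Variables (R : nzRingType) (U V W U' V' W' : lmodType R).
Variables (g : {linear U -> V}) (f : {linear V -> W}).
Variables (g' : {linear U' -> V'}) (f' : {linear V' -> W'}).
Variable h : {linear V -> V'}.
Hypothesis h_ker : forall x, f x = 0 -> f' (h x) = 0.
Hypothesis h_im : forall u, exists u', h (g u) = g' u'.

Fact hmap_ker (z : kernel f) : h (val z) \in ker_pred f'.
Proof. by rewrite inE h_ker ?kernelP. Qed.

Definition kernel_map (z : kernel f) : kernel f' :=
  exist _ (h (val z)) (hmap_ker z).

Definition homology_map (c : homology g f) : homology g' f' :=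
  hclass g' (kernel_map (repr c)).

Lemma homology_mapE z :
  homology_map (hclass g z) = hclass g' (kernel_map z).
Proof.
apply/hclass_eq; rewrite /= -linearB.
have /hclass_eq[u ->] : hclass g (repr (hclass g z)) = hclass g z.
  by rewrite /hclass reprK.
exact: h_im.
Qed.

Fact homology_map_is_linear : linear homology_map.
Proof.
move=> a c1 c2; have [z1 ->] := hclass_surj c1; have [z2 ->] := hclass_surj c2.
rewrite -linearP !homology_mapE -linearP; congr hclass.
by apply: val_inj; rewrite /= linearP.
Qed.

End InducedMap.

Arguments hclass {R U V W} g {f} z.
Arguments kernel_map {R V W V' W' f f' h} h_ker z.
Arguments homology_map {R U V W U' V' W' g f} g' {f' h} h_ker c.

Section SeriesDerivation.
Variables (n : nat) (R : comNzRingType).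
Implicit Types f g : fps n R.

Fact fpsderiv_is_linear i : linear (@fpsderiv n R i).
Proof.
move=> a f g; apply: fpsP => m /=.
by rewrite mulrnDl mulrnAr.
Qed.
HB.instance Definition _ i :=
  GRing.isLinear.Build R (fps n R) (fps n R) _ (@fpsderiv n R i)
    (fpsderiv_is_linear i).

Lemma fpsderivC i j f : fpsderiv i (fpsderiv j f) = fpsderiv j (fpsderiv i f).
Proof.
apply: fpsP => m /=; have [->//|ne_ij] := eqVneq i j.
rewrite -!mulrnA !mnmDE !mnm1E (negPf ne_ij) eq_sym (negPf ne_ij) !addn0 mulnC.
by rewrite -!addmA (addmC U_(i)%MM).
Qed.

Lemma fpsderivX i j : fpsderiv i (fpsX R j) = (i == j)%:R :> fps n R.
Proof.
apply: fpsP => m; rewrite [LHS]/=.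
have [->|ne_ij] := eqVneq i j.
  rewrite -{2}[U_(j)%MM]add0m eqm_add2r; rewrite fps1E.
  by case: eqP => [->|_]; rewrite ?mul0rn // mnm0E.
have /negPf->: (m + U_(i))%MM != U_(j)%MM.
  apply/eqP => /mnmP/(_ i); rewrite mnmDE !mnm1E eqxx eq_sym (negPf ne_ij).
  by rewrite addn1.
by rewrite mul0rn.
Qed.

End SeriesDerivation.

(* \sum_I w_I dx_I, where dx_I is the exterior product of the dx_i, i \in I,
   in increasing order of i; all degrees are put together *)
Notation forms n R := {ffun {set 'I_n} -> fps n R}.

Reserved Notation "a '\w' b" (at level 35, right associativity).

Section Forms.
Variables (n : nat) (R : comNzRingType).
Local Notation Omega := (forms n R).
Implicit Types (f : fps n R) (a b w : Omega) (i j : 'I_n) (I J K : {set 'I_n}).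

(* number of inversions: dx_I /\ dx_J = (-1)^(ninv I J) dx_(I :|: J) for
   disjoint I and J *)
Definition ninv I J : nat :=
  #|[set p : 'I_n * 'I_n in setX I J | (p.2 < p.1)%N]|.

Definition wedge a b : Omega :=
  [ffun K : {set 'I_n} =>
     \sum_(I : {set 'I_n} | I \subset K)
       (-1) ^+ ninv I (K :\: I) * (a I * b (K :\: I))].
Local Notation "a '\w' b" := (wedge a b).

Definition form0 f : Omega := [ffun K => if K == set0 then f else 0].
Definition dx i : Omega := [ffun K => (K == [set i])%:R].
Definition vol : Omega := [ffun K => (K == [set: 'I_n])%:R].
Definition fscale f w : Omega := [ffun K => f * w K].

Definition coefderiv i w : Omega := [ffun K => fpsderiv i (w K)].
Definition ext_deriv w : Omega := \sum_i (dx i \w coefderiv i w).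
Definition diff f : Omega := ext_deriv (form0 f).

(* contraction with the vector field d/dx_i *)
Definition contr i w : Omega :=
  [ffun K : {set 'I_n} => if i \in K then 0
             else (-1) ^+ #|[set j in K | (j < i)%N]| * w (i |: K)].

Definition kforms (k : int) : {pred Omega} :=
  [pred w : Omega | [forall K : {set 'I_n}, (#|K|%:Z != k) ==> (w K == 0)]].

Lemma kformsP k w :
  reflect (forall K, #|K|%:Z != k -> w K = 0) (w \in kforms k).
Proof.
apply: (iffP forallP) => w_k K; first by move=> neK; apply/eqP/(implyP (w_k K)).
by apply/implyP => /w_k->.
Qed.

Fact kforms_submod k : submod_closed (kforms k).
Proof.
split=> [|a x y /kformsP x_k /kformsP y_k]; apply/kformsP => K neK.
  by rewrite ffunE.
by rewrite !ffunE x_k ?y_k // scaler0 addr0.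
Qed.
HB.instance Definition _ k :=
  GRing.isSubmodClosed.Build R Omega (kforms k) (kforms_submod k).

Lemma wedge_dxE i w K : (dx i \w w) K =
  if i \in K then (-1) ^+ #|[set j in K | (j < i)%N]| * w (K :\ i) else 0.
Proof.
rewrite ffunE; case: ifP => [iK | /negP niK]; last first.
  rewrite big1 // => I sIK; rewrite ffunE; case: eqP => [I_i|]; last first.
    by rewrite mul0r mulr0.
  by case: niK; rewrite (subsetP sIK) // I_i set11.
rewrite (bigD1 [set i]) ?sub1set //= big1 ?addr0 => [|I /andP[_ /negPf neI]].
  rewrite ffunE eqxx mul1r; congr (_ ^+ _ * _); rewrite /ninv.
  rewrite -(card_imset _ (_ : injective (fun j : 'I_n => (i, j)))); last first.
    by move=> j1 j2 [].
  apply: eq_card => -[i1 j]; rewrite !inE /=; apply/idP/imsetP.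
    case/andP=> /and3P[/eqP-> ne_ji jK] lt_ji; exists j => //.
    by rewrite inE jK.
  case=> j'; rewrite inE => /andP[j'K lt_j'i] [-> ->].
  by rewrite eqxx j'K lt_j'i -val_eqE ltn_eqF.
by rewrite ffunE neI mul0r mulr0.
Qed.

Fact wedge_is_linear a : linear (wedge a).
Proof.
move=> c u v; apply/ffunP => K; rewrite !ffunE scaler_sumr -big_split /=.
apply: eq_bigr => I _; rewrite !ffunE !mulrDr; congr (_ + _).
by rewrite -!scalerAr.
Qed.
HB.instance Definition _ a :=
  GRing.isLinear.Build R Omega Omega _ (wedge a) (wedge_is_linear a).

Lemma wedgeDl a b w : (a + b) \w w = a \w w + b \w w.
Proof.
apply/ffunP => K; rewrite !ffunE -big_split /=.
by apply: eq_bigr => I _; rewrite !ffunE mulrDl mulrDr.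
Qed.

Lemma wedge0l w : 0 \w w = 0.
Proof. by apply: (addrI (0 \w w)); rewrite -wedgeDl !addr0. Qed.

Lemma wedge_suml T (r : seq T) (P : pred T) (F : T -> Omega) w :
  (\sum_(i <- r | P i) F i) \w w = \sum_(i <- r | P i) (F i \w w).
Proof.
exact: (big_morph (wedge^~ w) (fun a b => wedgeDl a b w) (wedge0l w)).
Qed.

Lemma wedge_fscalel f a b : fscale f a \w b = fscale f (a \w b).
Proof.
apply/ffunP => K; rewrite !ffunE mulr_sumr; apply: eq_bigr => I _.
by rewrite !ffunE -mulrA mulrCA.
Qed.

Lemma wedge_fscaler f a b : a \w fscale f b = fscale f (a \w b).
Proof.
apply/ffunP => K; rewrite !ffunE mulr_sumr; apply: eq_bigr => I _.
by rewrite !ffunE [a I * _]mulrCA [LHS]mulrCA.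
Qed.

Fact coefderiv_is_linear i : linear (coefderiv i).
Proof. by move=> c u v; apply/ffunP => K; rewrite !ffunE linearP. Qed.
HB.instance Definition _ i :=
  GRing.isLinear.Build R Omega Omega _ (coefderiv i) (coefderiv_is_linear i).

Fact ext_deriv_is_linear : linear ext_deriv.
Proof.
move=> c u v; rewrite /ext_deriv scaler_sumr -big_split /=.
by apply: eq_bigr => i _; rewrite !linearP.
Qed.
HB.instance Definition _ :=
  GRing.isLinear.Build R Omega Omega _ ext_deriv ext_deriv_is_linear.

Fact contr_is_linear i : linear (contr i).
Proof.
move=> c u v; apply/ffunP => K; rewrite !ffunE; case: ifP => _.
  by rewrite scaler0 addr0.
by rewrite mulrDr -scalerAr.
Qed.
HB.instance Definition _ i :=
  GRing.isLinear.Build R Omega Omega _ (contr i) (contr_is_linear i).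

Fact fscale_is_linear f : linear (fscale f).
Proof. by move=> c u v; apply/ffunP => K; rewrite !ffunE mulrDr -scalerAr. Qed.
HB.instance Definition _ f :=
  GRing.isLinear.Build R Omega Omega _ (fscale f) (fscale_is_linear f).

Lemma wedge_dx_sq i w : dx i \w dx i \w w = 0.
Proof.
apply/ffunP => K; rewrite !wedge_dxE !inE eqxx mulr0 ffunE.
by case: ifP.
Qed.

Let card_ltD1 i j K : i \in K ->
  #|[set l in K | (l < j)%N]| = ((i < j) + #|[set l in K :\ i | (l < j)%N]|)%N.
Proof.
move=> iK; rewrite (cardsD1 i) inE iK; congr (_ + _)%N.
by apply: eq_card => l; rewrite !inE andbA.
Qed.

Lemma wedge_dx_anti i j w : dx i \w dx j \w w = - (dx j \w dx i \w w).
Proof.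
have [->|ne_ij] := eqVneq i j; first by rewrite wedge_dx_sq oppr0.
apply/ffunP => K; rewrite [RHS]ffunE !wedge_dxE !inE (eq_sym j) ne_ij /=.
have [iK|] := boolP (i \in K); last by case: ifP; rewrite ?mulr0 oppr0.
have [jK|] := boolP (j \in K); last by rewrite mulr0 oppr0.
rewrite (card_ltD1 i jK) (card_ltD1 j iK) !setDDl (setUC [set j]).
rewrite !mulrA -!exprD -mulNr; congr (_ * _).
have -> : (i < j)%N = ~~ (j < i)%N.
  by rewrite -leqNgt ltn_neqAle val_eqE ne_ij.
move: #|_| #|_| => x y.
case: (j < i)%N => /=; rewrite add0n add1n.
  by rewrite addSn exprS mulN1r addnC.
by rewrite addSn exprS mulN1r opprK addnC.
Qed.

Lemma coefderiv_dx i j w : coefderiv i (dx j \w w) = dx j \w coefderiv i w.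
Proof.
apply/ffunP => K; rewrite [LHS]ffunE !wedge_dxE.
case: ifP => _; last by rewrite linear0.
rewrite ffunE; elim: #|_| => [|c IHc]; first by rewrite !expr0 !mul1r.
by rewrite !exprS -!mulrA !mulN1r linearN /= IHc.
Qed.

Lemma coefderivC i j w :
  coefderiv i (coefderiv j w) = coefderiv j (coefderiv i w).
Proof. by apply/ffunP => K; rewrite !ffunE fpsderivC. Qed.

Lemma sum_pairs (V : zmodType) (F : 'I_n -> 'I_n -> V) :
  (forall i, F i i = 0) ->
  \sum_(i < n) \sum_(j < n) F i j =
  \sum_(i < n) \sum_(j < n | (i < j)%N) (F i j + F j i).
Proof.
move=> Fdiag.
have split_lt i : \sum_(j < n) F i j =
    \sum_(j < n | (i < j)%N) F i j + \sum_(j < n | (j < i)%N) F i j.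
  rewrite (bigID (fun j : 'I_n => (i < j)%N)) /=; congr (_ + _).
  rewrite (bigD1 i) ?ltnn //= Fdiag add0r; apply: eq_bigl => j.
  by rewrite -leqNgt [RHS]ltn_neqAle -val_eqE andbC.
rewrite (eq_bigr _ (fun i _ => split_lt i)) big_split /=.
rewrite [X in _ + X](exchange_big_dep xpredT) //= -big_split /=.
by apply: eq_bigr => i _; rewrite -big_split.
Qed.

Lemma ext_deriv_sq w : ext_deriv (ext_deriv w) = 0.
Proof.
rewrite {1}/ext_deriv.
rewrite (eq_bigr (fun i => \sum_j
           (dx i \w dx j \w coefderiv i (coefderiv j w)))); last first.
  move=> i _; rewrite /ext_deriv !linear_sum.
  by apply: eq_bigr => j _; rewrite /= coefderiv_dx.
rewrite sum_pairs => [|i]; last exact: wedge_dx_sq.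
rewrite big1 // => i _; rewrite big1 // => j _.
by rewrite wedge_dx_anti coefderivC addNr.
Qed.

Lemma kforms_wedge_dx k i w : w \in kforms k -> dx i \w w \in kforms (k + 1).
Proof.
move=> /kformsP w_k; apply/kformsP => K neK; rewrite wedge_dxE.
case: ifP => // iK; rewrite w_k ?mulr0 //.
by apply: contra neK => /eqP <-; rewrite (cardsD1 i) iK addrC.
Qed.

Lemma kforms_coefderiv k i w : w \in kforms k -> coefderiv i w \in kforms k.
Proof.
move=> /kformsP w_k; apply/kformsP => K neK.
by rewrite ffunE w_k // linear0.
Qed.

Lemma kforms_ext_deriv k w : w \in kforms k -> ext_deriv w \in kforms (k + 1).
Proof.
by move=> w_k; apply: rpred_sum => i _; exact/kforms_wedge_dx/kforms_coefderiv.
Qed.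

Lemma kforms_contr k i w : w \in kforms k -> contr i w \in kforms (k - 1).
Proof.
move=> /kformsP w_k; apply/kformsP => K neK; rewrite ffunE.
case: ifP => // /negbT niK; rewrite w_k ?mulr0 //.
apply: contra neK => /eqP <-.
by rewrite cardsU1 niK add1n -addn1 PoszD addrK.
Qed.

Lemma kforms_fscale k f w : w \in kforms k -> fscale f w \in kforms k.
Proof.
move=> /kformsP w_k; apply/kformsP => K neK.
by rewrite ffunE w_k // mulr0.
Qed.

Lemma diffE f : diff f = \sum_i fscale (fpsderiv i f) (dx i).
Proof.
apply: eq_bigr => i _; apply/ffunP => K; rewrite wedge_dxE !ffunE.
case: ifPn => [iK|niK]; last first.
  by case: eqP niK => [->|_]; rewrite ?set11 // mulr0.
have [->|neK] := eqVneq K [set i].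
  rewrite setDv eqxx mulr1.
  rewrite (_ : [set j in [set i] | _] = set0) ?cards0 ?mul1r //.
  by apply/setP => j; rewrite !inE; case: eqP => // ->; rewrite ltnn.
rewrite mulr0 ifN ?linear0 ?mulr0 // setD_eq0 subset1 negb_or neK.
by apply/set0Pn; exists i.
Qed.

Lemma diff_fpsX i : diff (fpsX R i) = dx i.
Proof.
rewrite diffE (bigD1 i) //= big1 ?addr0 => [|j ne_ji].
  by apply/ffunP => K; rewrite ffunE fpsderivX eqxx mul1r.
by apply/ffunP => K; rewrite !ffunE fpsderivX (negPf ne_ji) mul0r.
Qed.

Lemma diff_coef f i : diff f [set i] = fpsderiv i f.
Proof.
rewrite diffE sum_ffunE (bigD1 i) //= big1 ?addr0 => [|j ne_ji].
  by rewrite !ffunE eqxx mulr1.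
by rewrite !ffunE (inj_eq set1_inj) eq_sym (negPf ne_ji) mulr0.
Qed.

Lemma wedge_diffl f w : diff f \w w = \sum_i fscale (fpsderiv i f) (dx i \w w).
Proof.
by rewrite diffE wedge_suml; apply: eq_bigr => i _; rewrite wedge_fscalel.
Qed.

Lemma kforms_diff f : diff f \in kforms 1.
Proof.
rewrite -[1]add0r; apply: kforms_ext_deriv; apply/kformsP => K.
by rewrite ffunE; have [->|//] := eqVneq K set0; rewrite cards0.
Qed.

Lemma kforms_wedge_diff k f w :
  w \in kforms k -> diff f \w w \in kforms (k + 1).
Proof.
move=> w_k; rewrite wedge_diffl; apply: rpred_sum => i _.
exact/kforms_fscale/kforms_wedge_dx.
Qed.

(* p stands for \sum_(i < j) p_ij d/dx_i /\ d/dx_j; only the entries p_ij with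
   i < j matter *)
Definition bivector := 'I_n -> 'I_n -> fps n R.
Implicit Types p : bivector.

(* p(a, b) for 1-forms a and b *)
Definition bivector_eval p a b : fps n R :=
  \sum_(i < n) \sum_(j < n | (i < j)%N)
     p i j * (a [set i] * b [set j] - a [set j] * b [set i]).

Lemma bivector_eval_dx p i j :
  (i < j)%N -> bivector_eval p (dx i) (dx j) = p i j.
Proof.
move=> lt_ij; rewrite /bivector_eval (bigD1 i) //= (bigD1 j) //=.
have ne_ij : (i == j) = false by rewrite -val_eqE ltn_eqF.
rewrite !ffunE !(inj_eq set1_inj) !eqxx (eq_sym j) ne_ij mulr0 subr0 !mulr1.
rewrite big1 => [|j' /andP[lt_ij' /negPf ne_j']]; last first.
  rewrite !ffunE !(inj_eq set1_inj) ne_j' (eq_sym j') -!val_eqE /=.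
  by rewrite (ltn_eqF lt_ij') mulr0 mul0r subrr mulr0.
rewrite addr0 big1 ?addr0 // => i' /negPf ne_i'; rewrite big1 // => j' lt_i'j'.
rewrite !ffunE !(inj_eq set1_inj) ne_i' mul0r sub0r.
have [j'i|] := eqVneq j' i; last by rewrite mul0r oppr0 mulr0.
have /negPf->: i' != j.
  by apply: contraTneq lt_ij => <-; rewrite -leqNgt -j'i ltnW.
by rewrite mulr0 oppr0 mulr0.
Qed.

(* contr j (contr i w) is the contraction with d/dx_i /\ d/dx_j *)
Definition bivector_contr p w : Omega :=
  \sum_(i < n) \sum_(j < n | (i < j)%N) fscale (p i j) (contr j (contr i w)).

Fact bivector_contr_is_linear p : linear (bivector_contr p).
Proof.
move=> c u v; rewrite /bivector_contr scaler_sumr -big_split /=.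
apply: eq_bigr => i _; rewrite scaler_sumr -big_split /=.
by apply: eq_bigr => j _; rewrite !linearP.
Qed.
HB.instance Definition _ p := GRing.isLinear.Build R Omega Omega _
  (bivector_contr p) (bivector_contr_is_linear p).

Lemma kforms_bivector_contr p k w :
  w \in kforms k -> bivector_contr p w \in kforms (k - 1 - 1).
Proof.
move=> w_k; do 2![apply: rpred_sum => ? _].
exact/kforms_fscale/kforms_contr/kforms_contr.
Qed.

Definition poisson_diff p w : Omega :=
  bivector_contr p (ext_deriv w) - ext_deriv (bivector_contr p w).

Fact poisson_diff_is_linear p : linear (poisson_diff p).
Proof.
by move=> c u v; rewrite /poisson_diff !linearP /= scalerBr scalerN addrACA.
Qed.
HB.instance Definition _ p := GRing.isLinear.Build R Omega Omega _
  (poisson_diff p) (poisson_diff_is_linear p).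

Lemma kforms_poisson_diff p k w :
  w \in kforms k -> poisson_diff p w \in kforms (k - 1).
Proof.
move=> w_k; apply: rpredB.
  by have := kforms_bivector_contr p (kforms_ext_deriv w_k); rewrite addrK.
by have := kforms_ext_deriv (kforms_bivector_contr p w_k); rewrite subrK.
Qed.

Lemma ext_deriv_poisson_diff p w :
  ext_deriv (poisson_diff p w) = - poisson_diff p (ext_deriv w).
Proof.
by rewrite /poisson_diff linearB /= !ext_deriv_sq !linear0 addr0 sub0r opprK.
Qed.

End Forms.

Notation "a '\w' b" := (wedge a b) : ring_scope.

Section PoissonHomology.
Variables (n : nat) (R : comNzRingType).

(* degrees are integers, with no nonzero form in degree k < 0 or k > n, so that
   the end terms of the complexes need no special treatment; the two
   differentials are indexed by a proof of l = k + 1 to avoid casts *)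
Definition form (k : int) := {w : forms n R | w \in kforms k}.
HB.instance Definition _ k := SubChoice.on (form k).
HB.instance Definition _ k := [SubChoice_isSubLmodule of form k by <:].

Section Differentials.
Variables (k l : int) (e : l = k + 1).

Fact form_d_subproof (w : form k) : ext_deriv (val w) \in kforms l.
Proof. by rewrite e; apply: kforms_ext_deriv; exact: valP. Qed.

Definition form_d (w : form k) : form l :=
  exist _ (ext_deriv (val w)) (form_d_subproof w).

Fact form_d_is_linear : linear form_d.
Proof. by move=> c u v; apply: val_inj; rewrite /= linearP. Qed.
HB.instance Definition _ :=
  GRing.isLinear.Build R (form k) (form l) _ form_d form_d_is_linear.

Variable p : bivector n R.

Fact form_delta_subproof (w : form l) : poisson_diff p (val w) \in kforms k.
Proof.
have -> : k = l - 1 by rewrite e addrK.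
by apply: kforms_poisson_diff; exact: valP.
Qed.

Definition form_delta (w : form l) : form k :=
  exist _ (poisson_diff p (val w)) (form_delta_subproof w).

Fact form_delta_is_linear : linear form_delta.
Proof. by move=> c u v; apply: val_inj; rewrite /= linearP. Qed.
HB.instance Definition _ :=
  GRing.isLinear.Build R (form l) (form k) _ form_delta form_delta_is_linear.

End Differentials.

Variable p : bivector n R.

Fact pred_succ (k : int) : k = k - 1 + 1. Proof. by rewrite subrK. Qed.

Definition poisson_homology (k : int) :=
  homology (form_delta (erefl (k + 1)) p) (form_delta (pred_succ k) p).

Definition poisson_cycle (k : int) := kernel (form_delta (pred_succ k) p).

Definition poisson_class (k : int) (z : poisson_cycle k) : poisson_homology k :=
  hclass _ z.

Section InducedDifferential.
Variables (k l : int) (e : l = k + 1).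

Fact homology_d_ker (w : form k) :
  form_delta (pred_succ k) p w = 0 ->
  form_delta (pred_succ l) p (form_d e w) = 0.
Proof.
move=> /(congr1 val)/= dw0; apply: val_inj => /=; apply: oppr_inj.
by rewrite -ext_deriv_poisson_diff dw0 linear0 oppr0.
Qed.

Fact homology_d_im (w : form (k + 1)) : exists w' : form (l + 1),
  form_d e (form_delta (erefl (k + 1)) p w) = form_delta (erefl (l + 1)) p w'.
Proof.
have e' : l + 1 = k + 1 + 1 by rewrite e.
exists (- form_d e' w); rewrite linearN; apply: val_inj.
by rewrite /= ext_deriv_poisson_diff.
Qed.

Definition homology_d : poisson_homology k -> poisson_homology l :=
  homology_map (form_delta (erefl (l + 1)) p) homology_d_ker.

Fact homology_d_is_linear : linear homology_d.
Proof. exact: (homology_map_is_linear homology_d_ker homology_d_im). Qed.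
HB.instance Definition _ := GRing.isLinear.Build R
  (poisson_homology k) (poisson_homology l) _ homology_d homology_d_is_linear.

Lemma homology_d_class (z : poisson_cycle k) :
  homology_d (poisson_class z) = poisson_class (kernel_map homology_d_ker z).
Proof. exact: (homology_mapE homology_d_ker homology_d_im z). Qed.

End InducedDifferential.

Definition derham_homology (k : int) :=
  homology (homology_d (pred_succ k)) (homology_d (erefl (k + 1))).

End PoissonHomology.

Section Jacobian.
Variable R : comNzRingType.

Definition x1 : fps 4 R := fpsX R (inord 0).
Definition x2 : fps 4 R := fpsX R (inord 1).
Definition x3 : fps 4 R := fpsX R (inord 2).
Definition x4 : fps 4 R := fpsX R (inord 3).

Definition f1 : fps 4 R := x1 ^+ 2 - x2 ^+ 2 + x3 ^+ 2 - x4 ^+ 2.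
Definition f2 : fps 4 R := 2 * (x1 * x2 + x3 * x4).

(* pi(dg, dh) vol = dg /\ dh /\ df1 /\ df2 for g = x_i, h = x_j; see
   jacobian_bivectorP for arbitrary g and h *)
Definition jacobian_bivector : bivector 4 R := fun i j =>
  (dx R i \w dx R j \w diff f1 \w diff f2) [set: 'I_4].

Lemma jacobian_bivectorP g h :
  fscale (bivector_eval jacobian_bivector (diff g) (diff h)) (vol 4 R) =
  diff g \w diff h \w diff f1 \w diff f2.
Proof.
set t := diff f1 \w diff f2.
have t2 : t \in kforms 2 := kforms_wedge_diff f1 (kforms_diff f2).
have /kformsP gh4 : diff g \w diff h \w t \in kforms 4.
  exact: (kforms_wedge_diff g (kforms_wedge_diff h t2)).
apply/ffunP => K; rewrite [LHS]ffunE [X in _ * X]ffunE.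
have [->|neK] := eqVneq K setT; last first.
  rewrite mulr0 gh4 //; apply: contra neK => /eqP[K4].
  by rewrite eqEcard subsetT cardsT card_ord K4.
rewrite mulr1 /bivector_eval wedge_diffl sum_ffunE.
transitivity (\sum_(i < 4) \sum_(j < 4)
    fpsderiv i g * fpsderiv j h * jacobian_bivector i j).
  rewrite sum_pairs => [|i]; last first.
    by rewrite /jacobian_bivector wedge_dx_sq ffunE mulr0.
  apply: eq_bigr => i _; apply: eq_bigr => j _; rewrite !diff_coef.
  rewrite /jacobian_bivector (wedge_dx_anti j i) [(- _ : forms 4 R) _]ffunE.
  ring.
apply: eq_bigr => i _; rewrite ffunE wedge_diffl linear_sum sum_ffunE mulr_sumr.
by apply: eq_bigr => j _; rewrite /= wedge_fscaler ffunE mulrA.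
Qed.

Lemma jacobian_bivector_unique (p : bivector 4 R) :
  (forall g h, fscale (bivector_eval p (diff g) (diff h)) (vol 4 R) =
     diff g \w diff h \w diff f1 \w diff f2) ->
  forall i j : 'I_4, (i < j)%N -> p i j = jacobian_bivector i j.
Proof.
move=> p_def i j lt_ij; have := p_def (fpsX R i) (fpsX R j).
rewrite !diff_fpsX bivector_eval_dx // => /ffunP/(_ setT).
by rewrite [fscale _ _ _]ffunE [vol _ _ _]ffunE eqxx mulr1.
Qed.

End Jacobian.

(* Main.v *)
(** The de Rham differential and the Poisson differential [delta] both preserve
the weight for which every [x_i] and every [dx_i] has weight 1, because the
Jacobian bivector has quadratic coefficients. Let [iota] be the contraction with
the Euler field. By Cartan's formula [d iota + iota d] multiplies forms of
weight [k] by [k], and hence [iota] anticommutes with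
[delta = [iota_pi, d]]: by the Jacobi identity their anticommutator is
[[iota_pi, d iota + iota d]], which vanishes since [iota_pi] preserves the
weight. Dividing by the weight, [iota] becomes a contracting homotopy of
Poisson homology in positive weight, and only the constants, which form the
weight 0 part, survive. *)

Require Import Defs.
From HB Require Import structures.
From mathcomp Require Import all_boot all_order all_algebra.
From mathcomp Require Import ring boolp reals mpoly.

Set Implicit Arguments.
Unset Strict Implicit.
Unset Printing Implicit Defensive.

Import GRing.Theory Num.Theory.
Local Open Scope ring_scope.

(** * Formal power series: coordinates, derivatives and homogeneity *)

Section Series.
Variables (n : nat) (R : comNzRingType).
Implicit Types f g h : fps n R.

Lemma fpsXME i f (m : 'X_{1..n}) :
  (fpsX R i * f) m = if (0 < m i)%N then f (m - U_(i))%MM else 0.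
Proof.
rewrite fpsME; case: ifP => [m_i | /negbT]; last first.
  rewrite -eqn0Ngt => /eqP m_i; rewrite big1 // => k /eqP mE /=.
  case: eqP => [k1E|]; last by rewrite mul0r.
  have := congr1 (fun q : 'X_{1..n} => q i) mE.
  by rewrite mnmDE k1E mnm1E eqxx m_i.
have leUm : (U_(i) <= m)%MM by rewrite lep1mP -lt0n.
have ltU : (mdeg U_(i) < (mdeg m).+1)%N.
  by rewrite ltnS mdeg1 mdegE (bigD1 i) //= ltn_addr.
have ltB : (mdeg (m - U_(i)) < (mdeg m).+1)%N by rewrite ltnS mdegB.
(* Only the term taking [x_i] from the first factor survives in the Cauchy product. *)
rewrite (bigD1 (BMultinom ltU, BMultinom ltB)) /=; last first.
  by rewrite addmC submK.
rewrite eqxx mul1r big1 ?addr0 // => -[k1 k2] /= /andP[/eqP mE neU].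
case: (_ =P U_(i)%MM) => [k1E|]; last by rewrite mul0r.
case/negP: neU; apply/eqP; congr (_, _); apply: val_inj; rewrite [val _]/= //.
apply/mnmP => j.
have := congr1 (fun q : 'X_{1..n} => q j) mE.
by rewrite k1E mnmBE mnmDE => ->; rewrite addKn.
Qed.

Lemma fpsderivE i f (m : 'X_{1..n}) :
  fpsderiv i f m = f (m + U_(i))%MM *+ (m i).+1.
Proof. by []. Qed.

(** Summed over [i], this yields the contribution of [mdeg m] to the weight in [cartan_euler]. *)
Lemma fpsX_deriv i f (m : 'X_{1..n}) :
  (fpsX R i * fpsderiv i f) m = f m *+ m i.
Proof.
rewrite fpsXME; case: (posnP (m i)) => [->|m_i]; first by rewrite mulr0n.
have leUm : (U_(i) <= m)%MM by rewrite lep1mP -lt0n.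
by rewrite /= submK // mnmBE mnm1E eqxx subn1 prednK.
Qed.

Lemma fpsderivXM i j f :
  fpsderiv i (fpsX R j * f) = f *+ (i == j) + fpsX R j * fpsderiv i f.
Proof.
apply: fpsP => m; rewrite fpsDE fpsderivE !fpsXME mnmDE mnm1E.
have [->|ne_ij] := eqVneq i j.
  have -> : (m + U_(j) - U_(j))%MM = m.
    by apply/mnmP => k; rewrite mnmBE mnmDE addnK.
  rewrite addn1 /= mulrS; congr (_ + _).
  case: (posnP (m j)) => [->//|m_j].
  have leUm : (U_(j) <= m)%MM by rewrite lep1mP -lt0n.
  by rewrite submK // mnmBE mnm1E eqxx subn1 prednK.
rewrite addn0 fps0E add0r; case: ifP => m_j; last by rewrite mul0rn.
have ne_ji : (j == i) = false by rewrite eq_sym; exact: negbTE.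
rewrite /= mnmBE mnm1E ne_ji subn0.
congr (f _ *+ _); apply/mnmP => k; rewrite !(mnmBE, mnmDE) !mnm1E.
by case: (i =P k) => [<-|_]; rewrite ?ne_ji ?subn0 ?addn0.
Qed.

Definition fps_homog d f := forall m : 'X_{1..n}, mdeg m != d -> f m = 0.

Lemma fps_homogX i : fps_homog 1 (fpsX R i).
Proof. by move=> m /=; case: (m =P _) => // ->; rewrite mdeg1 eqxx. Qed.

Lemma fps_homog0 d : fps_homog d (0 : fps n R).
Proof. by []. Qed.

Lemma fps_homogD d f g : fps_homog d f -> fps_homog d g -> fps_homog d (f + g).
Proof. by move=> df dg m ne; rewrite fpsDE df ?dg ?addr0. Qed.

Lemma fps_homogN d f : fps_homog d f -> fps_homog d (- f).
Proof. by move=> df m ne; rewrite fpsNE df ?oppr0. Qed.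

Lemma fps_homog_sum d I (r : seq I) (P : pred I) (F : I -> fps n R) :
  (forall i, P i -> fps_homog d (F i)) ->
  fps_homog d (\sum_(i <- r | P i) F i).
Proof.
by move=> dF; apply: (big_ind (fps_homog d)) => //; exact: fps_homogD.
Qed.

Lemma fps_homogM d e f g :
  fps_homog d f -> fps_homog e g -> fps_homog (d + e) (f * g).
Proof.
move=> df eg m ne; rewrite fpsME big1 // => k /eqP mE.
have [dk|/df->] := eqVneq (mdeg k.1) d; last by rewrite mul0r.
have [ek|/eg->] := eqVneq (mdeg k.2) e; last by rewrite mulr0.
by case/eqP: ne; rewrite mE mdegD dk ek.
Qed.

Lemma fps_homog_deriv d i f : fps_homog d.+1 f -> fps_homog d (fpsderiv i f).
Proof.
by move=> df m ne /=; rewrite df ?mul0rn // mdegD mdeg1 addn1.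
Qed.

Lemma fps_homog1 : fps_homog 0 (1 : fps n R).
Proof.
by move=> m; rewrite fps1E; case: (m =P _) => // ->; rewrite mdeg0 eqxx.
Qed.

Lemma fps_homog_sign d c f : fps_homog d f -> fps_homog d ((-1) ^+ c * f).
Proof.
move=> df; rewrite -signr_odd mulr_sign; case: odd => //.
exact: fps_homogN.
Qed.

End Series.

(** * Euler contraction and weight operators on forms *)

Section Forms.
Variables (n : nat) (R : comNzRingType).
Local Notation Omega := (forms n R).
Implicit Types (f : fps n R) (w : Omega) (i j : 'I_n) (K : {set 'I_n}).

Lemma card_ltU1 i j K : i \notin K ->
  #|[set l in i |: K | (l < j)%N]| = ((i < j) + #|[set l in K | (l < j)%N]|)%N.
Proof.
move=> niK; rewrite (cardsD1 i) !inE eqxx /=; congr (_ + _)%N.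
apply: eq_card => l; rewrite !inE; case: eqP => [->|] //=.
by rewrite (negPf niK).
Qed.

Lemma card_ltD1 i K :
  #|[set l in K | (l < i)%N]| = #|[set l in K :\ i | (l < i)%N]|.
Proof.
apply: eq_card => l; rewrite !inE.
by have [->|] := eqVneq l i; rewrite ?ltnn ?andbF.
Qed.

Lemma contr_anti i j w : contr i (contr j w) = - contr j (contr i w).
Proof.
apply/ffunP => K; rewrite !ffunE !inE (eq_sym j).
have [iK|niK] := boolP (i \in K); first by rewrite orbT mulr0 if_same oppr0.
have [jK|njK] := boolP (j \in K); first by rewrite orbT mulr0 oppr0.
rewrite !orbF; have [_|ne_ij] := eqVneq i j; first by rewrite !mulr0 oppr0.
rewrite !card_ltU1 // setUCA.
(* The two orders of insertion differ by one inversion, whence the single sign. *)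
have -> : (i < j)%N = ~~ (j < i)%N.
  by rewrite -leqNgt ltn_neqAle val_eqE ne_ij.
by case: (j < i)%N; rewrite /= !exprD ?expr1 ?expr0; ring.
Qed.

(** Contraction is an antiderivation, and [d/dx_j] pairs with [dx_i] to the Kronecker delta. *)
Lemma contr_wedge_dx i j w :
  contr j (dx R i \w w) = w *+ (i == j) - dx R i \w contr j w.
Proof.
apply/ffunP => K; rewrite [RHS]ffunE [X in _ + X]ffunE !wedge_dxE.
rewrite 2![contr _ _ _]ffunE wedge_dxE !inE.
have [<-|ne_ij] := eqVneq i j.
  rewrite /=; have [iK|niK] := boolP (i \in K).
    rewrite setD1K // card_ltD1.
    by rewrite mulrA -expr2 sqrr_sign mul1r subrr.
  rewrite setU1K // oppr0 addr0 card_ltU1 // ltnn add0n.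
  by rewrite mulrA -expr2 sqrr_sign mul1r.
rewrite /= mulr0n ffunE add0r.
have [iK|niK] := boolP (i \in K); last by rewrite mulr0 oppr0; case: ifP.
have [jK|njK] := boolP (j \in K); first by rewrite mulr0 oppr0.
have -> : (j |: K) :\ i = j |: (K :\ i).
  by apply/setP => l; rewrite !inE; case: eqP => [->|]; rewrite ?(negPf ne_ij).
rewrite card_ltU1 // -[in X in (-1) ^+ X * _ = _](setD1K iK).
rewrite card_ltU1 ?setD11 //.
have -> : (i < j)%N = ~~ (j < i)%N.
  by rewrite -leqNgt ltn_neqAle val_eqE ne_ij.
by case: (j < i)%N; rewrite /= !exprD ?expr1 ?expr0; ring.
Qed.

Lemma contr_fscale i f w : contr i (fscale f w) = fscale f (contr i w).
Proof.
apply/ffunP => K; rewrite !ffunE; case: ifP => _; first by rewrite mulr0.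
by rewrite mulrCA.
Qed.

Lemma fscaleC f (g : fps n R) w : fscale f (fscale g w) = fscale g (fscale f w).
Proof. by apply/ffunP => K; rewrite !ffunE mulrCA. Qed.

Lemma fpsderiv_sign i c f :
  fpsderiv i ((-1) ^+ c * f) = (-1) ^+ c * fpsderiv i f.
Proof. by rewrite -signr_odd !mulr_sign; case: odd; rewrite ?linearN. Qed.

Lemma coefderiv_contr i j w :
  coefderiv i (contr j w) = contr j (coefderiv i w).
Proof.
apply/ffunP => K; rewrite !ffunE; case: ifP => _; first by rewrite linear0.
by rewrite fpsderiv_sign.
Qed.

Lemma coefderiv_fscaleX i j w : coefderiv i (fscale (fpsX R j) w) =
  w *+ (i == j) + fscale (fpsX R j) (coefderiv i w).
Proof.
apply/ffunP => K; rewrite !ffunE fpsderivXM; congr (_ + _).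
by case: (i == j); rewrite ?mulr1n // !mulr0n ffunE.
Qed.

(** Interior product with the Euler field, the sum of the [x_i d/dx_i]. *)
Definition euler w : Omega := \sum_i fscale (fpsX R i) (contr i w).

Fact euler_is_linear : linear euler.
Proof.
move=> c u v; rewrite /euler scaler_sumr -big_split /=.
by apply: eq_bigr => i _; rewrite !linearP.
Qed.
HB.instance Definition _ :=
  GRing.isLinear.Build R Omega Omega _ euler euler_is_linear.

Lemma kforms_euler k w : w \in kforms k -> euler w \in kforms (k - 1).
Proof.
by move=> w_k; apply: rpred_sum => i _; exact/kforms_fscale/kforms_contr.
Qed.

(** The monomial form [x^m dx_K] has weight [mdeg m + #|K|]. An arbitrary [lam] covers at once
    multiplication by the weight, division by it, and projection to weight 0. *)
Definition wscale (lam : nat -> R) w : Omega :=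
  [ffun K : {set 'I_n} =>
     Fps (fun m : 'X_{1..n} => lam (mdeg m + #|K|)%N * w K m)].

Fact wscale_is_linear lam : linear (wscale lam).
Proof.
move=> c u v; apply/ffunP => K; rewrite !ffunE; apply: fpsP => m /=.
by rewrite mulrDr mulrCA.
Qed.
HB.instance Definition _ lam :=
  GRing.isLinear.Build R Omega Omega _ (wscale lam) (wscale_is_linear lam).

Lemma kforms_wscale lam k w : w \in kforms k -> wscale lam w \in kforms k.
Proof.
move=> /kformsP w_k; apply/kformsP => K neK.
by rewrite ffunE w_k //; apply: fpsP => m /=; rewrite mulr0.
Qed.

Lemma fps_signE c f (m : 'X_{1..n}) : ((-1) ^+ c * f) m = (-1) ^+ c * f m.
Proof. by rewrite -signr_odd -[in RHS]signr_odd !mulr_sign; case: odd. Qed.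

(** Wedging with [dx_i] raises the weight by one, so [lam] must be read one step further on the
    factor [w]. *)
Lemma wscale_wedge_dx lam i w :
  wscale lam (dx R i \w w) = dx R i \w wscale (lam \o succn) w.
Proof.
apply/ffunP => K; rewrite ffunE !wedge_dxE; apply: fpsP => m /=.
case: ifP => [iK|_]; last by rewrite mulr0.
by rewrite !fps_signE ffunE /= (cardsD1 i) iK addnS mulrCA.
Qed.

Lemma wscale_coefderiv lam i w :
  wscale (lam \o succn) (coefderiv i w) = coefderiv i (wscale lam w).
Proof.
apply/ffunP => K; rewrite !ffunE; apply: fpsP => m /=.
by rewrite mdegD mdeg1 addn1 addSn mulrnAr.
Qed.

Lemma wscale_contr lam i w :
  wscale (lam \o succn) (contr i w) = contr i (wscale lam w).
Proof.
apply/ffunP => K; rewrite !ffunE; apply: fpsP => m /=.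
case: ifPn => [_|niK]; first by rewrite mulr0.
by rewrite !fps_signE /= cardsU1 niK addnS mulrCA.
Qed.

Lemma wscale_fscale lam d f w : fps_homog d f ->
  wscale lam (fscale f w) = fscale f (wscale (lam \o addn d) w).
Proof.
move=> df; apply/ffunP => K; rewrite !ffunE; apply: fpsP => m.
rewrite [RHS]fpsME [LHS]/= mulr_sumr; apply: eq_bigr => k /eqP mE /=.
have [dk|/df->] := eqVneq (mdeg k.1) d; last by rewrite !mul0r mulr0.
have mdE : mdeg m = (d + mdeg k.2)%N by rewrite [in LHS]mE mdegD dk.
by rewrite addnA -mdE mulrCA.
Qed.

(** The weight gained from [dx_i] is lost again in the partial derivative. *)
Lemma wscale_ext_deriv lam w :
  wscale lam (ext_deriv w) = ext_deriv (wscale lam w).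
Proof.
rewrite linear_sum; apply: eq_bigr => i _ /=.
by rewrite wscale_wedge_dx wscale_coefderiv.
Qed.

(** Two contractions lower the weight by 2, and the quadratic coefficients restore it. *)
Lemma wscale_bivector_contr lam (p : bivector n R) w :
  (forall i j, fps_homog 2 (p i j)) ->
  wscale lam (bivector_contr p w) = bivector_contr p (wscale lam w).
Proof.
move=> p2; rewrite linear_sum; apply: eq_bigr => i _ /=.
rewrite linear_sum; apply: eq_bigr => j _ /=.
by rewrite (wscale_fscale _ _ (p2 i j)) -!wscale_contr.
Qed.

Lemma wscale_comp lam mu w :
  wscale lam (wscale mu w) = wscale (fun k => lam k * mu k) w.
Proof.
by apply/ffunP => K; rewrite !ffunE; apply: fpsP => m /=; rewrite mulrA.
Qed.

Lemma cartan_euler w :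
  ext_deriv (euler w) + euler (ext_deriv w) = wscale (fun k => k%:R) w.
Proof.
(* The first sum comes from differentiating the coefficients [x_j] of the Euler field. *)
have dE : ext_deriv (euler w) = \sum_j (dx R j \w contr j w) +
    \sum_i \sum_j fscale (fpsX R i) (dx R j \w contr i (coefderiv j w)).
  rewrite exchange_big -big_split /=; apply: eq_bigr => j _.
  rewrite /euler !linear_sum /= (bigD1 j) //= [in RHS](bigD1 j) //= addrA.
  rewrite coefderiv_fscaleX eqxx linearD /= wedge_fscaler coefderiv_contr.
  congr (_ + _); apply: eq_bigr => i ne_ij.
  rewrite coefderiv_fscaleX eq_sym (negPf ne_ij) add0r wedge_fscaler.
  by rewrite coefderiv_contr.
(* The diagonal terms of [contr_wedge_dx] give the Lie derivative on coefficients; the double sum is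
   the one of [dE] with opposite sign. *)
have Ed : euler (ext_deriv w) =
    \sum_i fscale (fpsX R i) (coefderiv i w) -
    \sum_i \sum_j fscale (fpsX R i) (dx R j \w contr i (coefderiv j w)).
  rewrite -sumrB; apply: eq_bigr => i _; rewrite !linear_sum /=.
  rewrite (bigD1 i) //= [in RHS](bigD1 i) //= contr_wedge_dx eqxx linearB /=.
  rewrite -addrA; congr (_ + (_ + _)).
  apply: eq_bigr => j ne_ji; rewrite contr_wedge_dx (negPf ne_ji) add0r.
  by rewrite linearN.
(* Of the two sums left, one counts the polynomial degree [mdeg m], the other the form degree
   [#|K|]. *)
rewrite dE Ed addrCA addrK; apply/ffunP => K; apply: fpsP => m.
rewrite ffunE fpsDE !sum_ffunE !fps_sumE [wscale _ _ _]ffunE.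
rewrite [RHS]/= natrD mulrDl; congr (_ + _).
  rewrite mdegE natr_sum mulr_suml; apply: eq_bigr => i _.
  by rewrite !ffunE fpsX_deriv mulr_natl.
rewrite -sum1_card natr_sum mulr_suml [RHS]big_mkcond /=.
apply: eq_bigr => i _; rewrite wedge_dxE; case: ifP => // iK.
rewrite ffunE setD11 setD1K // card_ltD1.
by rewrite mulrA -expr2 sqrr_sign !mul1r.
Qed.

(** Moving one contraction past two others produces two signs, which cancel. *)
Lemma euler_bivector_contr (p : bivector n R) w :
  euler (bivector_contr p w) = bivector_contr p (euler w).
Proof.
rewrite [RHS]linear_sum; apply: eq_bigr => k _ /=.
rewrite !linear_sum; apply: eq_bigr => i _ /=.
rewrite !linear_sum; apply: eq_bigr => j _ /=.
rewrite !contr_fscale fscaleC; congr (fscale _ (fscale _ _)).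
by rewrite (contr_anti k j) (contr_anti k i) linearN opprK.
Qed.

Lemma euler_poisson_diff (p : bivector n R) w :
  (forall i j, fps_homog 2 (p i j)) ->
  euler (poisson_diff p w) = - poisson_diff p (euler w).
Proof.
move=> p2; rewrite /poisson_diff linearB /= euler_bivector_contr.
(* Cartan's formula eliminates [euler (ext_deriv (bivector_contr p w))] on the left and
   [ext_deriv (euler w)] on the right. The resulting weight terms agree because [bivector_contr p]
   preserves the weight. *)
have /(canRL (addKr _)) -> := cartan_euler (bivector_contr p w).
have /(canRL (addrK _)) -> := cartan_euler w.
rewrite !linearB /= wscale_bivector_contr // euler_bivector_contr.
by rewrite opprD !opprK addrA -[RHS]addrA addrC.
Qed.

End Forms.

(** * Weight zero and the constant coefficient *)

Section Weights.
Variables (n : nat) (R : comNzRingType) (p : bivector n R).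
Hypothesis p_quad : forall i j, fps_homog 2 (p i j).
Implicit Types w : forms n R.

Lemma wscale_poisson_diff lam w :
  wscale lam (poisson_diff p w) = poisson_diff p (wscale lam w).
Proof.
rewrite linearB /= wscale_bivector_contr // !wscale_ext_deriv.
by rewrite wscale_bivector_contr.
Qed.

Definition const_coef w : R^o := w set0 0%MM.

Fact const_coef_is_linear : linear const_coef.
Proof. by move=> c u v; rewrite /const_coef !ffunE. Qed.
HB.instance Definition _ := GRing.isLinear.Build R (forms n R) R^o _
  const_coef const_coef_is_linear.

(** Weight 0 forces both [m = 0] and [K = set0], so its only coefficient is the constant one. *)
Lemma wscale_weight0 w :
  const_coef w = 0 -> wscale (fun k => (k == 0)%:R) w = 0.
Proof.
move=> w0; apply/ffunP => K; rewrite !ffunE; apply: fpsP => m /=.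
rewrite addn_eq0 mdeg_eq0 cards_eq0.
by have [->|_] := eqVneq m 0%MM; have [->|_] := eqVneq K set0;
  rewrite ?mul0r // mul1r -[RHS]w0.
Qed.

Lemma const_coef_ext_deriv w : const_coef (ext_deriv w) = 0.
Proof.
rewrite /const_coef sum_ffunE fps_sumE big1 // => i _.
by rewrite wedge_dxE inE.
Qed.

(** The exact summand has no component on [set0]; the other one is a combination with quadratic
    coefficients, hence without constant term. *)
Lemma const_coef_poisson_diff w : const_coef (poisson_diff p w) = 0.
Proof.
rewrite linearB /= const_coef_ext_deriv subr0 /const_coef.
rewrite sum_ffunE fps_sumE big1 // => i _.
rewrite sum_ffunE fps_sumE big1 // => j _; rewrite ffunE fpsME big1 // => k _.
rewrite p_quad ?mul0r //.
by rewrite ltn_eqF // (leq_trans (bmdeg k.1)) // mdeg0.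
Qed.

End Weights.

(** * The contracting homotopy in positive weight *)

Section EulerHomotopy.
Variables (n : nat) (R : numFieldType) (p : bivector n R).
Hypothesis p_quad : forall i j, fps_homog 2 (p i j).
Implicit Types w z u : forms n R.

(** In weight 0 the convention that the inverse of 0 is 0 discards the constant. *)
Definition weight_inv w : forms n R := wscale (fun k => k%:R^-1) w.

(** Cartan's formula for [weight_inv z] returns [z]. Its term [euler (ext_deriv (weight_inv z))]
    equals [euler (poisson_diff p (weight_inv u))], and anticommutation turns this into a Poisson
    boundary. *)
Lemma euler_homotopy z u :
  const_coef z = 0 -> ext_deriv z = poisson_diff p u ->
  z = ext_deriv (euler (weight_inv z)) - poisson_diff p (euler (weight_inv u)).
Proof.
move=> z0 dz; rewrite -(euler_poisson_diff _ p_quad).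
rewrite -wscale_poisson_diff // -dz wscale_ext_deriv cartan_euler wscale_comp.
(* With 0 replaced by the weight 0 projection of [z], each weight [k] requires that 1 minus [k]
   times its inverse be 1 for [k = 0] and 0 otherwise. *)
apply/eqP; rewrite -subr_eq0 -(wscale_weight0 z0); apply/eqP/ffunP => K.
rewrite !ffunE; apply: fpsP => m; rewrite fpsDE fpsNE /=.
case: (mdeg m + #|K|)%N => [|k]; first by rewrite !mul0r mul1r subr0.
by rewrite divff ?pnatr_eq0 // mul1r mul0r subrr.
Qed.

(** A closed class only provides some [u] with [dy = delta u], which is exactly the input of
    [euler_homotopy]. *)
Lemma closed_class_exact (k : int) (y : poisson_cycle p k) :
    const_coef (val (val y)) = 0 ->
    homology_d (erefl (k + 1)) (poisson_class y) = 0 ->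
  exists b : poisson_homology p (k - 1),
    poisson_class y = homology_d (pred_succ k) b.
Proof.
move=> y0; rewrite homology_d_class.
rewrite -[RHS](linear0 (hclass (form_delta (erefl (k + 1 + 1)) p))).
case/hclass_eq => u /(congr1 val) /=; rewrite subr0 => dy.
have v_form : euler (weight_inv (val (val y))) \in kforms (k - 1).
  by apply/kforms_euler/kforms_wscale/valP.
have x_form : euler (weight_inv (val u)) \in kforms (k + 1).
  rewrite -[k + 1 in X in _ \in X](addrK 1).
  by apply/kforms_euler/kforms_wscale/valP.
pose v : Defs.form n R (k - 1) :=
  exist _ (euler (weight_inv (val (val y)))) v_form.
pose x : Defs.form n R (k + 1) :=
  exist _ (euler (weight_inv (val u))) x_form.
(* The primitive [v] is again a cycle, since [euler] anticommutes with [delta] and weight scaling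
   commutes with it. *)
have v_ker : v \in ker_pred (form_delta (pred_succ (k - 1)) p).
  rewrite inE; apply/eqP/val_inj => /=; apply: oppr_inj.
  rewrite -euler_poisson_diff // -wscale_poisson_diff //.
  by have /(congr1 val)/= -> := kernelP y; rewrite !linear0.
exists (poisson_class (exist _ v v_ker)); rewrite homology_d_class.
(* By [euler_homotopy], [y - dv = - delta x]. *)
apply/hclass_eq; exists (- x); apply: val_inj => /=.
by rewrite linearN /= {1}(euler_homotopy y0 dy) addrAC subrr add0r.
Qed.

End EulerHomotopy.

(** * De Rham cohomology of the Poisson homology *)

Section DerhamHomology.
Variables (n : nat) (R : numFieldType) (p : bivector n R).
Hypothesis p_quad : forall i j, fps_homog 2 (p i j).

Lemma const_coef_class k (y y' : poisson_cycle p k) :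
  poisson_class y = poisson_class y' ->
  const_coef (val (val y)) = const_coef (val (val y')).
Proof.
case/hclass_eq => u /(congr1 val) /= yB; apply/eqP.
by rewrite -subr_eq0 -linearB /= yB const_coef_poisson_diff.
Qed.

Lemma poisson_class_surj k (c : poisson_homology p k) :
  exists y : poisson_cycle p k, c = poisson_class y.
Proof. exact: hclass_surj. Qed.

Local Notation closed0 := (kernel (homology_d (p := p) (erefl (0 + 1)))).

(** The two uses of [repr] choose representatives in the two nested quotients. *)
Definition const_coef_homology (c : derham_homology p 0) : R^o :=
  const_coef (val (val (repr (val (repr c))))).

(** Independence of representatives: two choices differ by a de Rham exact form and a Poisson
    boundary, and neither has a constant coefficient. *)
Lemma const_coef_homologyE (z : closed0) (y : poisson_cycle p 0) :
  val z = poisson_class y ->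
  const_coef_homology (hclass _ z) = const_coef (val (val y)).
Proof.
move=> zE; rewrite /const_coef_homology; set z' := repr (hclass _ z).
have /hclass_eq[b]: hclass (homology_d (pred_succ 0)) z' = hclass _ z.
  by rewrite /hclass reprK.
have [x ->] := poisson_class_surj b; rewrite /= homology_d_class => zB.
have y'E : poisson_class (repr (val z')) = val z'.
  by rewrite /poisson_class /hclass reprK.
move: zB; rewrite zE -{1}y'E -linearB => /const_coef_class/=.
rewrite linearB /= const_coef_ext_deriv => /eqP.
by rewrite subr_eq0 => /eqP.
Qed.

Fact const_coef_homology_is_linear : linear const_coef_homology.
Proof.
move=> a c1 c2; have [z1 ->] := hclass_surj c1; have [z2 ->] := hclass_surj c2.
have [y1 E1] := poisson_class_surj (val z1).
have [y2 E2] := poisson_class_surj (val z2).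
rewrite -linearP !(const_coef_homologyE E1) !(const_coef_homologyE E2).
rewrite (@const_coef_homologyE _ (a *: y1 + y2)) /=; first by rewrite linearP.
by rewrite E1 E2 -linearP.
Qed.
HB.instance Definition _ := GRing.isLinear.Build R (derham_homology p 0) R^o _
  const_coef_homology const_coef_homology_is_linear.

Lemma const_coef_homology_inj : injective const_coef_homology.
Proof.
apply: raddf_inj => c /=; have [z ->] := hclass_surj c.
have [y zE] := poisson_class_surj (val z).
rewrite (const_coef_homologyE zE) => y0.
have := kernelP z; rewrite zE => /(closed_class_exact p_quad y0)[b yE].
rewrite -[RHS](linear0 (hclass _)); apply/hclass_eq; exists b.
by rewrite subr0 zE.
Qed.

Lemma const_coef_homology_surj (a : R^o) : exists c, const_coef_homology c = a.
Proof.
pose w : forms n R := form0 (a *: 1).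
have w_form : w \in kforms 0.
  apply/kformsP => K; rewrite ffunE.
  by have [->|//] := eqVneq K set0; rewrite cards0.
(* A constant is its own weight 0 projection. Both differentials commute with this projection and
   have no constant coefficient, so they kill [w]. *)
have w_weight : w = wscale (fun k => (k == 0)%:R) w.
  apply/ffunP => K; rewrite !ffunE; apply: fpsP => m.
  rewrite /= addn_eq0 mdeg_eq0 cards_eq0.
  case: (K =P set0) => _; last by rewrite mulr0.
  rewrite andbT !fpsZE !fps1E.
  by case: (m =P 0%MM); rewrite ?mul1r // mulr0 mul0r.
pose v : Defs.form n R 0 := exist _ w w_form.
have v_cycle : v \in ker_pred (form_delta (pred_succ 0) p).
  rewrite inE; apply/eqP/val_inj => /=.
  rewrite w_weight -wscale_poisson_diff // wscale_weight0 //.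
  exact: const_coef_poisson_diff.
pose y : poisson_cycle p 0 := exist _ v v_cycle.
have y_closed :
    poisson_class y \in ker_pred (homology_d (p := p) (erefl (0 + 1))).
  rewrite inE /= homology_d_class -[X in _ == X](linear0 (hclass _)); apply/eqP.
  congr hclass; apply/val_inj/val_inj => /=.
  by rewrite w_weight -wscale_ext_deriv wscale_weight0 // const_coef_ext_deriv.
pose z : closed0 := exist _ (poisson_class y) y_closed.
exists (hclass _ z); rewrite (@const_coef_homologyE z y) //.
by rewrite /const_coef ffunE eqxx fpsZE fps1E eqxx mulr1.
Qed.

Lemma derham_homology0_iso :
  exists phi : {linear derham_homology p 0 -> R^o}, bijective phi.
Proof.
have [psi phiK] := choice const_coef_homology_surj.
exists const_coef_homology; exists psi => // c.
by apply: const_coef_homology_inj; rewrite phiK.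
Qed.

Lemma derham_homology_eq0 (k : int) (c : derham_homology p k) : k != 0 -> c = 0.
Proof.
move=> k_neq0; have [z ->] := hclass_surj c.
have [y zE] := poisson_class_surj (val z).
(* Outside degree 0 a form has no component on [set0]. *)
have y0 : const_coef (val (val y)) = 0.
  have /kformsP y_k := valP (val y).
  by rewrite /const_coef y_k // cards0 eq_sym.
have := kernelP z; rewrite zE => /(closed_class_exact p_quad y0)[b yE].
rewrite -[RHS](linear0 (hclass _)); apply/hclass_eq; exists b.
by rewrite subr0 zE.
Qed.

End DerhamHomology.

(** * Quadratic coefficients of the Jacobian bivector *)

Section JacobianQuadratic.
Variable R : comNzRingType.

Lemma fps_homog_wedge n d e (a b : forms n R) K :
  (forall I, fps_homog d (a I)) -> (forall I, fps_homog e (b I)) ->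
  fps_homog (d + e) ((a \w b) K).
Proof.
move=> ad be; rewrite ffunE; apply: fps_homog_sum => I _.
by apply/fps_homog_sign/fps_homogM.
Qed.

Lemma fps_homog_diff n d (f : fps n R) K :
  fps_homog d.+1 f -> fps_homog d (diff f K).
Proof.
move=> df; rewrite diffE sum_ffunE; apply: fps_homog_sum => i _; rewrite !ffunE.
rewrite -[d]addn0; apply: fps_homogM; first exact: fps_homog_deriv.
by case: eqP => _; [exact: fps_homog1 | exact: fps_homog0].
Qed.

Lemma fps_homogX2 n i j : fps_homog 2 (fpsX R i * fpsX R j : fps n R).
Proof. by apply: (@fps_homogM _ _ 1 1); exact: fps_homogX. Qed.

Lemma f1_homog : fps_homog 2 (f1 R).
Proof.
rewrite /f1 !expr2.
by do ?[apply: fps_homogX2 | apply: fps_homogN | apply: fps_homogD].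
Qed.

Lemma f2_homog : fps_homog 2 (f2 R).
Proof.
(* The factor 2 becomes a repeated sum, so closure under addition suffices. *)
rewrite /f2 mulr_natl mulr2n.
by do ?[apply: fps_homogX2 | apply: fps_homogD].
Qed.

Lemma jacobian_bivector_homog i j : fps_homog 2 (jacobian_bivector R i j).
Proof.
(* Differentials of coordinates have coefficients of degree 0, those of [f1] and [f2] degree 1, for
   a total of 2. *)
rewrite /jacobian_bivector -[dx R i]diff_fpsX -[dx R j]diff_fpsX.
apply: (@fps_homog_wedge _ 0 2) => [I|I].
  by apply: fps_homog_diff; apply: fps_homogX.
apply: (@fps_homog_wedge _ 0 2) => [J|J].
  by apply: fps_homog_diff; apply: fps_homogX.
by apply: (@fps_homog_wedge _ 1 1) => L; apply: fps_homog_diff;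
  [exact: f1_homog | exact: f2_homog].
Qed.

End JacobianQuadratic.

(** * Application to the Jacobian bivector *)

Theorem corollary1p5 (R : realType) :
  (forall (k l : int) (e : l = k + 1)
      (z : poisson_cycle (jacobian_bivector R) k),
    exists2 z' : poisson_cycle (jacobian_bivector R) l,
      val (val z') = ext_deriv (val (val z)) &
      homology_d e (poisson_class z) = poisson_class z')
  /\ (forall (k l m : int) (e : l = k + 1) (e' : m = l + 1)
      (c : poisson_homology (jacobian_bivector R) k),
    homology_d e' (homology_d e c) = 0)
  /\ (exists phi : {linear derham_homology (jacobian_bivector R) 0 -> R^o},
    bijective phi)
  /\ (forall k : int, k != 0 ->
    forall c : derham_homology (jacobian_bivector R) k, c = 0).
Proof.
have p_quad := @jacobian_bivector_homog R.
split=> [k l e z|].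
  exists (kernel_map (homology_d_ker e) z) => //.
  exact: homology_d_class.
split=> [k l m e e' c|].
  have [y ->] := poisson_class_surj c; rewrite !homology_d_class.
  rewrite -[RHS](linear0 (hclass _)); congr hclass; apply/val_inj/val_inj => /=.
  exact: ext_deriv_sq.
split; last by move=> k k_neq0 c; exact: derham_homology_eq0.
exact: derham_homology0_iso.
Qed.
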